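(* Let $\mathcal{P} \subseteq \mathbb{C}^{n_p}$, let $\mu$ be a measure over $\mathcal{P}$, let $H \in L_2(\mathcal{P}, \mu; \mathbb{C}^{n_o \times n_i})$, and let $\hat\alpha_i, \hat\beta_j, \hat\gamma_k \colon \mathcal{P} \to \mathbb{C}$ ($i = 1, \dots, q_A$; $j = 1, \dots, q_B$; $k = 1, \dots, q_C$) be measurable functions satisfying $$\int_{\mathcal{P}} \left( \frac{\sum_{j=1}^{q_B} |\hat\beta_j(p)| \, \sum_{k=1}^{q_C} |\hat\gamma_k(p)|}{\sum_{i=1}^{q_A} |\hat\alpha_i(p)|} \right)^{2} d\mu(p) < \infty .$$ Let $\Sigma_{\mathrm{St}}$ be the set of all tuples $(\hat A_i, \hat B_j, \hat C_k)$ with $\hat A_i \in \mathbb{C}^{r \times r}$, $\hat B_j \in \mathbb{C}^{r \times n_i}$, $\hat C_k \in \mathbb{C}^{n_o \times r}$ such that $\operatorname{ess\,sup}_{p \in \mathcal{P}} \| \hat\alpha_i(p) \hat{\mathcal{A}}(p)^{-1} \|_F < \infty$ for $i = 1, \dots, q_A$. Let $(\hat A_i, \hat B_j, \hat C_k)$ be an $L_2$-optimal StROM of $H$ among $\Sigma_{\mathrm{St}}$. Then $$\int_{\mathcal{P}} \overline{\hat\gamma_k(p)} \, H(p) \hat X(p)^* \, d\mu(p) = \int_{\mathcal{P}} \overline{\hat\gamma_k(p)} \, \hat H(p) \hat X(p)^* \, d\mu(p), \quad k = 1, \dots, q_C,$$ $$\int_{\mathcal{P}} \overline{\hat\beta_j(p)}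 \, \hat X_d(p) H(p) \, d\mu(p) = \int_{\mathcal{P}} \overline{\hat\beta_j(p)} \, \hat X_d(p) \hat H(p) \, d\mu(p), \quad j = 1, \dots, q_B,$$ $$\int_{\mathcal{P}} \overline{\hat\alpha_i(p)} \, \hat X_d(p) H(p) \hat X(p)^* \, d\mu(p) = \int_{\mathcal{P}} \overline{\hat\alpha_i(p)} \, \hat X_d(p) \hat H(p) \hat X(p)^* \, d\mu(p), \quad i = 1, \dots, q_A.$$
   Context: $n_p, n_o, n_i, r, q_A, q_B, q_C$ are positive integers; $(\cdot)^*$ is the conjugate transpose and $\|\cdot\|_F$ the Frobenius norm. For a tuple $(\hat A_i, \hat B_j, \hat C_k)$ (a structured reduced-order model, StROM) define $$\hat{\mathcal{A}}(p) = \sum_{i=1}^{q_A} \hat\alpha_i(p) \hat A_i, \quad \hat{\mathcal{B}}(p) = \sum_{j=1}^{q_B} \hat\beta_j(p) \hat B_j, \quad \hat{\mathcal{C}}(p) = \sum_{k=1}^{q_C} \hat\gamma_k(p) \hat C_k,$$ the reduced state $\hat X(p) = \hat{\mathcal{A}}(p)^{-1} \hat{\mathcal{B}}(p)$, the output $\hat H(p) = \hat{\mathcal{C}}(p) \hat X(p)$, and the dual reduced state $\hat X_d(p) = \hat{\mathcal{A}}(p)^{-*} \hat{\mathcal{C}}(p)^*$. A StROM is $L_2$-optimal for $H$ among a set of StROMs if it minimizes $\mathcal{J}(\hat A_i, \hat B_j, \hat C_k) = \int_{\mathcal{P}} \| H(p) - \hat H(p) \|_F^2 \, d\mu(p)$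 over that set. *)

(* Defs.v *)
From HB Require Import structures.
From mathcomp Require Import all_boot all_order all_algebra.
From mathcomp Require Export complex.
From mathcomp Require Import all_classical all_reals all_analysis.
From mathcomp Require Import ess_sup_inf.

Set Implicit Arguments.
Unset Strict Implicit.
Unset Printing Implicit Defensive.

Import Order.TTheory GRing.Theory Num.Theory.
Import numFieldNormedType.Exports.

Local Open Scope classical_set_scope.
Local Open Scope complex_scope.
Local Open Scope sesquilinear_scope.
Local Open Scope ring_scope.

(* Makes 'cV[R[i]]_n a pointedType, as measurable spaces are required to be. *)
HB.instance Definition _ (R : realType) := Pointed.copy R[i] (R[i])^o.

Definition cabs (R : realType) (z : R[i]) : R := ComplexField.Normc.normc z.

Definition frobenius (R : realType) (m n : nat) (A : 'M[R[i]]_(m, n)) : R :=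
  Num.sqrt (\sum_(i < m) \sum_(j < n) cabs (A i j) ^+ 2).

(* Functions are total on the ambient space [T]; only their values on [P]
   matter. *)

Definition cmeasurable (R : realType) (d : measure_display)
    (T : measurableType d) (P : set T) (f : T -> R[i]) : Prop :=
  measurable_fun P (fun p => complex.Re (f p)) /\
  measurable_fun P (fun p => complex.Im (f p)).

Definition mxmeasurable (R : realType) (d : measure_display)
    (T : measurableType d) (P : set T) (m n : nat)
    (F : T -> 'M[R[i]]_(m, n)) : Prop :=
  forall i j, cmeasurable P (fun p => F p i j).

Definition cintegrable (R : realType) (d : measure_display)
    (T : measurableType d) (mu : {measure set T -> \bar R}) (P : set T)
    (f : T -> R[i]) : Prop :=
  mu.-integrable P (fun p => (complex.Re (f p))%:E) /\
  mu.-integrable P (fun p => (complex.Im (f p))%:E).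

Definition mxintegrable (R : realType) (d : measure_display)
    (T : measurableType d) (mu : {measure set T -> \bar R}) (P : set T)
    (m n : nat) (F : T -> 'M[R[i]]_(m, n)) : Prop :=
  forall i j, cintegrable mu P (fun p => F p i j).

Definition cintegral (R : realType) (d : measure_display)
    (T : measurableType d) (mu : {measure set T -> \bar R}) (P : set T)
    (f : T -> R[i]) : R[i] :=
  (\int[mu]_(p in P) complex.Re (f p)) +i* (\int[mu]_(p in P) complex.Im (f p)).

Definition mxintegral (R : realType) (d : measure_display)
    (T : measurableType d) (mu : {measure set T -> \bar R}) (P : set T)
    (m n : nat) (F : T -> 'M[R[i]]_(m, n)) : 'M[R[i]]_(m, n) :=
  \matrix_(i, j) cintegral mu P (fun p => F p i j).

(* An equation between two integrals asserts in particular that both exist;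
   as [mxintegral] is total, this has to be said explicitly. *)
Definition eq_mxintegral (R : realType) (d : measure_display)
    (T : measurableType d) (mu : {measure set T -> \bar R}) (P : set T)
    (m n : nat) (F G : T -> 'M[R[i]]_(m, n)) : Prop :=
  [/\ mxintegrable mu P F, mxintegrable mu P G
    & mxintegral mu P F = mxintegral mu P G].

Definition mxL2 (R : realType) (d : measure_display)
    (T : measurableType d) (mu : {measure set T -> \bar R}) (P : set T)
    (m n : nat) (F : T -> 'M[R[i]]_(m, n)) : Prop :=
  mxmeasurable P F /\
  (\int[mu]_(p in P) ((frobenius (F p)) ^+ 2)%:E < +oo)%E.

Record strom (R : realType) (r ni no qA qB qC : nat) := StROM {
  Amx : 'I_qA -> 'M[R[i]]_r ;
  Bmx : 'I_qB -> 'M[R[i]]_(r, ni) ;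
  Cmx : 'I_qC -> 'M[R[i]]_(no, r) }.

Definition sepform (R : realType) (T : Type) (q m n : nat)
    (w : 'I_q -> T -> R[i]) (M : 'I_q -> 'M[R[i]]_(m, n)) (p : T)
    : 'M[R[i]]_(m, n) :=
  \sum_(i < q) w i p *: M i.

Definition redX (R : realType) (T : Type) (r ni no qA qB qC : nat)
    (alpha : 'I_qA -> T -> R[i]) (beta : 'I_qB -> T -> R[i])
    (s : strom R r ni no qA qB qC) (p : T) : 'M[R[i]]_(r, ni) :=
  invmx (sepform alpha (Amx s) p) *m sepform beta (Bmx s) p.

Definition redH (R : realType) (T : Type) (r ni no qA qB qC : nat)
    (alpha : 'I_qA -> T -> R[i]) (beta : 'I_qB -> T -> R[i])
    (gamma : 'I_qC -> T -> R[i])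
    (s : strom R r ni no qA qB qC) (p : T) : 'M[R[i]]_(no, ni) :=
  sepform gamma (Cmx s) p *m redX alpha beta s p.

Definition redXd (R : realType) (T : Type) (r ni no qA qB qC : nat)
    (alpha : 'I_qA -> T -> R[i]) (gamma : 'I_qC -> T -> R[i])
    (s : strom R r ni no qA qB qC) (p : T) : 'M[R[i]]_(r, no) :=
  (invmx (sepform alpha (Amx s) p))^t* *m (sepform gamma (Cmx s) p)^t*.

(* [invmx A] is [A] when [A] is singular, so the existence of the inverse for
   almost every [p], implicit in the ess sup bound, is a separate conjunct.
   [mrestr mu mP] is [mu] restricted to [P], which makes the supremum range
   over [P] only. *)
Definition SigmaSt (R : realType) (d : measure_display)
    (T : measurableType d) (mu : {measure set T -> \bar R}) (P : set T)
    (mP : measurable P) (r ni no qA qB qC : nat) (alpha : 'I_qA -> T -> R[i])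
    : set (strom R r ni no qA qB qC) :=
  [set s | {ae mu, forall p, P p -> sepform alpha (Amx s) p \in unitmx} /\
    forall i : 'I_qA,
      (ess_sup (mrestr mu mP)
         (fun p => (frobenius
            (alpha i p *: invmx (sepform alpha (Amx s) p)))%:E) < +oo)%E].

Definition L2cost (R : realType) (d : measure_display)
    (T : measurableType d) (mu : {measure set T -> \bar R}) (P : set T)
    (r ni no qA qB qC : nat) (alpha : 'I_qA -> T -> R[i])
    (beta : 'I_qB -> T -> R[i]) (gamma : 'I_qC -> T -> R[i])
    (H : T -> 'M[R[i]]_(no, ni)) (s : strom R r ni no qA qB qC) : \bar R :=
  (\int[mu]_(p in P) ((frobenius (H p - redH alpha beta gamma s p)) ^+ 2)%:E)%E.

Definition L2_optimal (R : realType) (d : measure_display)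
    (T : measurableType d) (mu : {measure set T -> \bar R}) (P : set T)
    (r ni no qA qB qC : nat) (alpha : 'I_qA -> T -> R[i])
    (beta : 'I_qB -> T -> R[i]) (gamma : 'I_qC -> T -> R[i])
    (H : T -> 'M[R[i]]_(no, ni)) (S : set (strom R r ni no qA qB qC))
    (s : strom R r ni no qA qB qC) : Prop :=
  S s /\ forall s', S s' ->
    (L2cost mu P alpha beta gamma H s <= L2cost mu P alpha beta gamma H s')%E.

(* Main.v *)
Require Import Defs.
From HB Require Import structures.
From mathcomp Require Import all_boot all_order all_algebra.
From mathcomp Require Import all_classical all_reals all_analysis.
From mathcomp Require Import measurable_realfun ess_sup_inf.
From mathcomp Require Import ring lra.

Set Implicit Arguments.
Unset Strict Implicit.
Unset Printing Implicit Defensive.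

Import Order.TTheory GRing.Theory Num.Theory.
Import numFieldNormedType.Exports.

Local Open Scope classical_set_scope.
Local Open Scope complex_scope.
Local Open Scope sesquilinear_scope.
Local Open Scope ring_scope.

(** The cost is a squared distance in a Hilbert space of matrix-valued
    functions, so a minimizer satisfies first-order conditions: if a curve of
    competitors has outputs [Hh + t D + O(t^2)], with [Hh] the optimal output,
    then the real inner product of [H - Hh] with [D] has integral zero
    ([stationary_mxdot]). Adding [t E] to one coefficient [C_k] or [B_j], or
    subtracting it from one [A_i], gives curves whose velocities have the form
    [D = w (U E V)], where, with [A], [B], [C] evaluated at the same parameter,
    - [w = gamma_k], [U = 1], [V = A^-1 B] for [C_k];
    - [w = beta_j], [U = C A^-1], [V = 1] for [B_j];
    - [w = alpha_i], [U = C A^-1], [V = A^-1 B] for [A_i].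
    Letting [E] run through the matrix units times [1] and [i] extracts the
    real and imaginary parts of all entries of the integral of
    [w^* U^* (H - Hh) V^*] ([mxdot_delta], [eq_mxintegral_of_stationary]),
    and this is the claim, since the dual state is the adjoint of [C A^-1].

    No differentiation under the integral sign takes place. Everything is
    dominated by one square-integrable function, the sum of [|H|] and of the
    weight [g = (sum |beta_j|) (sum |gamma_k|) / (sum |alpha_i|)]: the bounds
    on [alpha_i A^-1] that define the admissible models say that [|A^-1|] is
    at most a constant over [sum |alpha_i|], whence [|C| |A^-1| |B|] and the
    velocities are at most constants times [g] ([SigmaSt_bound],
    [pointwise_bounds]). For [B_j] and [C_k] the output is affine in [t]. For
    [A_i], the perturbed matrix is [A (1 - N)] with [|N|] of order [t]
    uniformly in the parameter, and two steps of the Neumann series bound the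
    remainder by [t^2] times a constant times [g] ([perturbed_invmx]); the same
    estimate keeps the perturbed model admissible for small [t]. The cost along
    each curve is thus at most a quadratic polynomial in [t] with finite
    coefficients, whose linear coefficient must vanish at a minimum.

    Integrability of both sides of each equation follows from the same
    domination, together with the measurability of matrix inversion
    ([mxmeasurable_inv]). *)

(** * The Frobenius norm and its real inner product *)

Section Frobenius.
Context {R : realType}.
Implicit Types (z w : R[i]).

Lemma sqr_cabs z : cabs z ^+ 2 = complex.Re z ^+ 2 + complex.Im z ^+ 2.
Proof. by case: z => a b; rewrite /cabs/= sqr_sqrtr// addr_ge0 ?sqr_ge0. Qed.

Lemma cabs_ge0 z : 0 <= cabs z.
Proof. by case: z => a b; rewrite /cabs/= sqrtr_ge0. Qed.

Lemma cabsM z w : cabs (z * w) = cabs z * cabs w.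
Proof. exact: ComplexField.Normc.normcM. Qed.

Lemma le_cabsD z w : cabs (z + w) <= cabs z + cabs w.
Proof. exact: le_normcD. Qed.

Lemma cabs0 : cabs 0 = 0 :> R.
Proof. exact: ComplexField.Normc.normc0. Qed.

Lemma cabs_real (t : R) : cabs t%:C = `|t|.
Proof. by rewrite /cabs/= expr0n addr0 sqrtr_sqr. Qed.

Lemma le_cabs_sum (I : Type) (s : seq I) (F : I -> R[i]) :
  cabs (\sum_(i <- s) F i) <= \sum_(i <- s) cabs (F i).
Proof.
elim: s => [|i s IH]; first by rewrite !big_nil cabs0.
by rewrite !big_cons (le_trans (le_cabsD _ _))// lerD2l.
Qed.

(** Lagrange's identity: the defect in the Cauchy-Schwarz inequality is half
    the sum of the squares of the minors [a i * b j - a j * b i]. *)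
Lemma sum_mul_sqr_le (I : finType) (a b : I -> R) :
  (\sum_i a i * b i) ^+ 2 <= (\sum_i a i ^+ 2) * (\sum_i b i ^+ 2).
Proof.
have H : 0 <= \sum_i \sum_j (a i * b j - a j * b i) ^+ 2.
  by do 2!apply: sumr_ge0 => ? _; exact: sqr_ge0.
have E : \sum_i \sum_j (a i * b j - a j * b i) ^+ 2 =
    2 * ((\sum_i a i ^+ 2) * (\sum_i b i ^+ 2) - (\sum_i a i * b i) ^+ 2).
  transitivity (\sum_i \sum_j (a i ^+ 2 * b j ^+ 2 + b i ^+ 2 * a j ^+ 2
                  - 2 * ((a i * b i) * (a j * b j)))).
    by apply: eq_bigr => i _; apply: eq_bigr => j _; ring.
  under eq_bigr do rewrite sumrB big_split/= -!mulr_sumr.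
  rewrite sumrB big_split/= -!mulr_suml -mulr_sumr -mulr_suml; ring.
by move: H; rewrite E pmulr_rge0// subr_ge0.
Qed.

Lemma frobenius_ge0 m n (A : 'M[R[i]]_(m, n)) : 0 <= frobenius A.
Proof. exact: sqrtr_ge0. Qed.

Lemma sqr_frobenius m n (A : 'M[R[i]]_(m, n)) :
  frobenius A ^+ 2 = \sum_i \sum_j cabs (A i j) ^+ 2.
Proof.
by rewrite sqr_sqrtr//; do 2!apply: sumr_ge0 => ? _; exact: sqr_ge0.
Qed.

Lemma frobeniusZ m n z (A : 'M[R[i]]_(m, n)) :
  frobenius (z *: A) = cabs z * frobenius A.
Proof.
apply/eqP; rewrite -(eqrXn2 (n := 2))// ?frobenius_ge0//; last first.
  by rewrite mulr_ge0// ?cabs_ge0 ?frobenius_ge0.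
rewrite exprMn !sqr_frobenius mulr_sumr; apply/eqP/eq_bigr => i _.
by rewrite mulr_sumr; apply: eq_bigr => j _; rewrite mxE cabsM exprMn.
Qed.

Lemma frobenius_eq0 m n (A : 'M[R[i]]_(m, n)) : frobenius A = 0 -> A = 0.
Proof.
move=> A0; have := sqr_frobenius A; rewrite A0 expr0n/= => /esym/eqP.
rewrite psumr_eq0 => [/allP H|i _]; last first.
  by apply: sumr_ge0 => j _; exact: sqr_ge0.
apply/matrixP => i j; rewrite mxE.
have := H i (mem_index_enum _); rewrite psumr_eq0; last first.
  by move=> k _; exact: sqr_ge0.
move=> /allP/(_ j (mem_index_enum _)); rewrite sqrf_eq0 => /eqP.
exact: ComplexField.Normc.eq0_normc.
Qed.

(** The inner product of the real Hilbert space underlying the complex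
    matrices: first-order optimality with respect to real step lengths only
    sees real parts. *)
Definition mxdot m n (A B : 'M[R[i]]_(m, n)) : R :=
  complex.Re (\tr (A *m B^t*)).

Lemma mxdotE m n (A B : 'M[R[i]]_(m, n)) :
  mxdot A B = \sum_i \sum_j (complex.Re (A i j) * complex.Re (B i j)
                              + complex.Im (A i j) * complex.Im (B i j)).
Proof.
have ReS (I : finType) (F : I -> R[i]) :
    complex.Re (\sum_i F i) = \sum_i complex.Re (F i).
  by apply: (big_morph (@complex.Re R)) => // -[? ?] [? ?].
rewrite /mxdot /mxtrace ReS; apply: eq_bigr => i _.
rewrite mxE ReS; apply: eq_bigr => j _; rewrite !mxE.
by case: (A i j) (B i j) => a b [c d]; rewrite /= mulrN opprK.
Qed.

Lemma ler_norm_mxdot m n (A B : 'M[R[i]]_(m, n)) :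
  `|mxdot A B| <= frobenius A * frobenius B.
Proof.
rewrite -(ler_pXn2r (n := 2))// ?nnegrE ?mulr_ge0 ?frobenius_ge0//.
rewrite real_normK ?num_real// exprMn !sqr_frobenius mxdotE.
have le1 : `|\sum_i \sum_j (complex.Re (A i j) * complex.Re (B i j)
      + complex.Im (A i j) * complex.Im (B i j))|
    <= \sum_(k : 'I_m * 'I_n) cabs (A k.1 k.2) * cabs (B k.1 k.2).
  rewrite pair_big/= (le_trans (ler_norm_sum _ _ _))//; apply: ler_sum => k _.
  rewrite -(ler_pXn2r (n := 2))// ?nnegrE ?mulr_ge0 ?cabs_ge0//.
  rewrite real_normK ?num_real// exprMn !sqr_cabs.
  set a := complex.Re _; set b := complex.Re _.
  set c := complex.Im _; set d := complex.Im _.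
  rewrite -subr_ge0 (_ : _ - _ = (a * d - c * b) ^+ 2) ?sqr_ge0//; ring.
rewrite -real_normK ?num_real//.
apply: (@le_trans _ _
  ((\sum_(k : 'I_m * 'I_n) cabs (A k.1 k.2) * cabs (B k.1 k.2)) ^+ 2)).
  by rewrite ler_pXn2r// nnegrE (le_trans _ le1).
by rewrite (le_trans (sum_mul_sqr_le _ _))// !pair_big.
Qed.

Lemma sqr_frobeniusD m n (A B : 'M[R[i]]_(m, n)) :
  frobenius (A + B) ^+ 2
    = frobenius A ^+ 2 + 2 * mxdot A B + frobenius B ^+ 2.
Proof.
rewrite !sqr_frobenius mxdotE mulr_sumr -!big_split/=; apply: eq_bigr => i _.
rewrite mulr_sumr -!big_split/=; apply: eq_bigr => j _.
rewrite mxE !sqr_cabs; case: (A i j) (B i j) => a b [c d] /=; ring.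
Qed.

Lemma mxdotZr m n (t : R) (A B : 'M[R[i]]_(m, n)) :
  mxdot A (t%:C *: B) = t * mxdot A B.
Proof.
rewrite !mxdotE mulr_sumr; apply: eq_bigr => i _.
rewrite mulr_sumr; apply: eq_bigr => j _; rewrite mxE.
case: (A i j) (B i j) => a b [c d] /=; ring.
Qed.

Lemma mxdotBl m n (A B D : 'M[R[i]]_(m, n)) :
  mxdot (A - B) D = mxdot A D - mxdot B D.
Proof.
by rewrite /mxdot mulmxBl raddfB/=; case: (\tr _) (\tr _) => ? ? [].
Qed.

Lemma le_frobeniusD m n (A B : 'M[R[i]]_(m, n)) :
  frobenius (A + B) <= frobenius A + frobenius B.
Proof.
rewrite -(ler_pXn2r (n := 2))// ?nnegrE ?addr_ge0 ?frobenius_ge0//.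
rewrite sqr_frobeniusD sqrrD lerD2r lerD2l mulr_natl lerMn2r/=.
exact: le_trans (ler_norm _) (ler_norm_mxdot _ _).
Qed.

Lemma frobeniusN m n (A : 'M[R[i]]_(m, n)) : frobenius (- A) = frobenius A.
Proof.
rewrite -scaleN1r frobeniusZ (_ : -1 = (-1 : R)%:C); last first.
  by rewrite rmorphN1.
by rewrite cabs_real normrN1 mul1r.
Qed.

Lemma le_frobenius_sum m n (I : Type) (s : seq I) (F : I -> 'M[R[i]]_(m, n)) :
  frobenius (\sum_(i <- s) F i) <= \sum_(i <- s) frobenius (F i).
Proof.
elim: s => [|i s IH]; last first.
  by rewrite !big_cons (le_trans (le_frobeniusD _ _))// lerD2l.
by rewrite !big_nil -[0](scale0r 0) frobeniusZ cabs0 mul0r.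
Qed.

Lemma le_frobeniusM m n p (A : 'M[R[i]]_(m, n)) (B : 'M[R[i]]_(n, p)) :
  frobenius (A *m B) <= frobenius A * frobenius B.
Proof.
rewrite -(ler_pXn2r (n := 2))// ?nnegrE ?mulr_ge0 ?frobenius_ge0//.
rewrite exprMn !sqr_frobenius mulr_suml; apply: ler_sum => i _.
rewrite (exchange_big_dep xpredT)//= mulr_sumr; apply: ler_sum => j _.
apply: le_trans (sum_mul_sqr_le _ _).
rewrite ler_pXn2r// ?nnegrE ?cabs_ge0//; last first.
  by apply: sumr_ge0 => k _; rewrite mulr_ge0 ?cabs_ge0.
rewrite mxE (le_trans (le_cabs_sum _ _))//.
by apply: ler_sum => k _; rewrite cabsM.
Qed.

Lemma le_frobenius_sepform (T : Type) q m n (w : 'I_q -> T -> R[i])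
    (M : 'I_q -> 'M[R[i]]_(m, n)) (p : T) :
  frobenius (sepform w M p)
    <= (\sum_i cabs (w i p)) * (\sum_i frobenius (M i)).
Proof.
rewrite (le_trans (le_frobenius_sum _ _))// mulr_suml.
apply: ler_sum => i _; rewrite frobeniusZ ler_wpM2l ?cabs_ge0//.
rewrite (bigD1 i)//= lerDl; apply: sumr_ge0 => j _; exact: frobenius_ge0.
Qed.

Lemma adjmxZ m n z (A : 'M[R[i]]_(m, n)) : (z *: A)^t* = z^* *: A^t*.
Proof. by apply/matrixP => i j; rewrite !mxE rmorphM. Qed.

Lemma adjmxM m n p (A : 'M[R[i]]_(m, n)) (B : 'M[R[i]]_(n, p)) :
  (A *m B)^t* = B^t* *m A^t*.
Proof. by rewrite trmx_mul map_mxM. Qed.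

Lemma mxtrace_delta_mul m n (A : 'M[R[i]]_(m, n)) i j :
  \tr (delta_mx j i *m A) = A i j.
Proof.
rewrite /mxtrace (bigD1 j)//= big1 => [|k kj]; last first.
  by rewrite mxE big1// => l _; rewrite mxE (negbTE kj) mul0r.
rewrite mxE (bigD1 i)//= big1 => [|l li]; last first.
  by rewrite mxE (negbTE li) andbF mul0r.
by rewrite mxE !eqxx mul1r !addr0.
Qed.

(** Testing against the directions [w *: (U *m E *m V)], with [E] a matrix
    unit times [1] or [i], recovers the real and imaginary parts of every
    entry of the compressed matrix [w^* *: (U^t* *m F *m V^t* )]. *)
Lemma mxdot_delta a b m n w (F : 'M[R[i]]_(m, n)) (U : 'M[R[i]]_(m, a))
    (V : 'M[R[i]]_(b, n)) z i j :
  mxdot F (w *: (U *m (z *: delta_mx i j) *m V))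
    = complex.Re (z^* * (w^* *: (U^t* *m F *m V^t*)) i j).
Proof.
rewrite /mxdot; congr complex.Re.
rewrite adjmxZ !adjmxM adjmxZ trmx_delta map_delta_mx.
rewrite -!(scalemxAl, scalemxAr) !mxtraceZ mxE mulrCA -mxtrace_delta_mul.
congr (_ * (_ * _)).
by rewrite mulmxA mxtrace_mulC -!mulmxA.
Qed.

End Frobenius.

(** * Inverses of perturbed matrices *)

Section Neumann.
Context {R : realType}.

Lemma unitmx_1B r (N : 'M[R[i]]_r) :
  frobenius N <= 2^-1 -> 1%:M - N \in unitmx.
Proof.
move=> N2; rewrite -row_free_unit; apply: inj_row_free => v.
rewrite mulmxBr mulmx1 => /eqP; rewrite subr_eq0 => /eqP vE.
apply: frobenius_eq0; apply/eqP; rewrite eq_le frobenius_ge0 andbT.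
have := le_frobeniusM v N; rewrite -vE => vN.
have := ler_wpM2l (frobenius_ge0 v) N2; lra.
Qed.

(** The first step of the Neumann series, with the exact remainder
    [N *m invmx A'] in place of the infinite tail. *)
Lemma perturbed_invmx r (A A' N : 'M[R[i]]_r) :
  A \in unitmx -> A' = A *m (1%:M - N) -> frobenius N <= 2^-1 ->
  [/\ A' \in unitmx, invmx A' = invmx A + N *m invmx A'
    & frobenius (invmx A') <= 2 * frobenius (invmx A)].
Proof.
move=> Au A'E N2; have A'u : A' \in unitmx.
  by rewrite A'E unitmx_mul Au unitmx_1B.
have E : invmx A' = invmx A + N *m invmx A'.
  apply/eqP; rewrite -subr_eq -{1}(mul1mx (invmx A')) -mulmxBl.
  by rewrite -(mulKmx Au (1%:M - N)) -A'E mulmxK.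
split => //; have := le_frobeniusD (invmx A) (N *m invmx A').
rewrite -E => /le_trans/(_ (lerD (lexx _) (le_frobeniusM _ _))).
have := ler_wpM2r (frobenius_ge0 (invmx A')) N2; lra.
Qed.

End Neumann.

(** * Measurability of complex-valued and matrix-valued functions *)

Section Measurability.
Context {R : realType} {d : measure_display} {T : measurableType d}.
Variable P : set T.
Implicit Types (f g : T -> R[i]).

Lemma cmeasurable_cst (z : R[i]) : cmeasurable P (fun=> z).
Proof. by split; exact: measurable_cst. Qed.

Lemma cmeasurableD f g : cmeasurable P f -> cmeasurable P g ->
  cmeasurable P (fun p => f p + g p).
Proof.
move=> [f1 f2] [g1 g2]; split.
  rewrite (_ : (fun p => _) = (fun p => complex.Re (f p) + complex.Re (g p))).
    exact: measurable_funD.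
  by apply/funext => p; case: (f p) (g p) => ? ? [].
rewrite (_ : (fun p => _) = (fun p => complex.Im (f p) + complex.Im (g p))).
  exact: measurable_funD.
by apply/funext => p; case: (f p) (g p) => ? ? [].
Qed.

Lemma cmeasurableM f g : cmeasurable P f -> cmeasurable P g ->
  cmeasurable P (fun p => f p * g p).
Proof.
move=> [f1 f2] [g1 g2]; split.
  rewrite (_ : (fun p => _) =
    (fun p => complex.Re (f p) * complex.Re (g p)
              - complex.Im (f p) * complex.Im (g p))).
    by apply: measurable_funB; exact: measurable_funM.
  by apply/funext => p; case: (f p) (g p) => ? ? [].
rewrite (_ : (fun p => _) =
  (fun p => complex.Re (f p) * complex.Im (g p)
            + complex.Im (f p) * complex.Re (g p))).
  by apply: measurable_funD; exact: measurable_funM.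
by apply/funext => p; case: (f p) (g p) => ? ? [].
Qed.

Lemma cmeasurable_big (I : Type) (op : R[i] -> R[i] -> R[i]) (idx : R[i])
    (s : seq I) (F : I -> T -> R[i]) :
  (forall f g, cmeasurable P f -> cmeasurable P g ->
     cmeasurable P (fun p => op (f p) (g p))) ->
  (forall i, cmeasurable P (F i)) ->
  cmeasurable P (fun p => \big[op/idx]_(i <- s) F i p).
Proof.
move=> mop mF; elim: s => [|i s IH].
  under eq_fun do rewrite big_nil.
  exact: cmeasurable_cst.
by under eq_fun do rewrite big_cons; exact: mop.
Qed.

(** Stated for nonnegative functions, where the reciprocal is the power [-1];
    the values at [0] agree as well. *)
Lemma measurable_fun_ge0V (f : T -> R) : (forall p, 0 <= f p) ->
  measurable_fun P f -> measurable_fun P (fun p => (f p)^-1).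
Proof.
move=> f0 mf; rewrite (_ : (fun p => _) = (@powR R ^~ (-1)) \o f).
  by apply: measurableT_comp => //; exact: measurable_powR.
by apply/funext => p /=; rewrite powR_inv1.
Qed.

Lemma cmeasurableV f : cmeasurable P f -> cmeasurable P (fun p => (f p)^-1).
Proof.
move=> [f1 f2].
pose n p := complex.Re (f p) ^+ 2 + complex.Im (f p) ^+ 2.
have mn : measurable_fun P (fun p => (n p)^-1).
  apply: measurable_fun_ge0V => [p|]; first by rewrite addr_ge0 ?sqr_ge0.
  by apply: measurable_funD; exact: measurable_funX.
split.
  rewrite (_ : (fun p => _) = (fun p => complex.Re (f p) * (n p)^-1)).
    exact: measurable_funM.
  by apply/funext => p; rewrite /n; case: (f p).
rewrite (_ : (fun p => _) = (fun p => - complex.Im (f p) * (n p)^-1)).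
  by apply: measurable_funM => //; exact: measurableT_comp.
by apply/funext => p; rewrite /n; case: (f p) => a b /=; rewrite mulNr.
Qed.

Lemma measurable_cabs f : cmeasurable P f ->
  measurable_fun P (fun p => cabs (f p)).
Proof.
move=> [f1 f2]; rewrite (_ : (fun p => _) =
  Num.sqrt \o (fun p => complex.Re (f p) ^+ 2 + complex.Im (f p) ^+ 2)).
  apply: measurableT_comp.
    by apply: continuous_measurable_fun; exact: sqrt_continuous.
  by apply: measurable_funD; exact: measurable_funX.
by apply/funext => p /=; case: (f p).
Qed.

Lemma measurable_sqr_frobenius m n (F : T -> 'M[R[i]]_(m, n)) :
  mxmeasurable P F -> measurable_fun P (fun p => frobenius (F p) ^+ 2).
Proof.
move=> mF; under eq_fun do rewrite sqr_frobenius.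
apply: measurable_sum => i; apply: measurable_sum => j.
by apply: measurable_funX; exact: measurable_cabs.
Qed.

Lemma measurable_frobenius m n (F : T -> 'M[R[i]]_(m, n)) :
  mxmeasurable P F -> measurable_fun P (fun p => frobenius (F p)).
Proof.
move=> mF; rewrite (_ : (fun p => _) =
  Num.sqrt \o (fun p => frobenius (F p) ^+ 2)).
  apply: measurableT_comp; last exact: measurable_sqr_frobenius.
  by apply: continuous_measurable_fun; exact: sqrt_continuous.
by apply/funext => p /=; rewrite sqrtr_sqr ger0_norm ?frobenius_ge0.
Qed.

Lemma mxmeasurable_cst m n (A : 'M[R[i]]_(m, n)) : mxmeasurable P (fun=> A).
Proof. by move=> i j; exact: cmeasurable_cst. Qed.

Lemma mxmeasurableD m n (F G : T -> 'M[R[i]]_(m, n)) :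
  mxmeasurable P F -> mxmeasurable P G -> mxmeasurable P (fun p => F p + G p).
Proof.
by move=> mF mG i j; under eq_fun do rewrite mxE; exact: cmeasurableD.
Qed.

Lemma mxmeasurableZ m n (w : T -> R[i]) (F : T -> 'M[R[i]]_(m, n)) :
  cmeasurable P w -> mxmeasurable P F -> mxmeasurable P (fun p => w p *: F p).
Proof.
by move=> mw mF i j; under eq_fun do rewrite mxE; exact: cmeasurableM.
Qed.

Lemma mxmeasurableB m n (F G : T -> 'M[R[i]]_(m, n)) :
  mxmeasurable P F -> mxmeasurable P G -> mxmeasurable P (fun p => F p - G p).
Proof.
move=> mF mG; under eq_fun do rewrite -scaleN1r.
by apply: mxmeasurableD => //; apply: mxmeasurableZ.
Qed.

Lemma mxmeasurableM m n q (F : T -> 'M[R[i]]_(m, n))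
    (G : T -> 'M[R[i]]_(n, q)) :
  mxmeasurable P F -> mxmeasurable P G -> mxmeasurable P (fun p => F p *m G p).
Proof.
move=> mF mG i j; under eq_fun do rewrite mxE.
by apply: cmeasurable_big => [f g|k]; [exact: cmeasurableD|exact: cmeasurableM].
Qed.

Lemma mxmeasurable_sepform q m n (w : 'I_q -> T -> R[i])
    (M : 'I_q -> 'M[R[i]]_(m, n)) :
  (forall i, cmeasurable P (w i)) -> mxmeasurable P (sepform w M).
Proof.
move=> mw i j; rewrite /sepform; under eq_fun do rewrite summxE.
apply: cmeasurable_big => [f g|k]; first exact: cmeasurableD.
under eq_fun do rewrite mxE.
by apply: cmeasurableM => //; exact: cmeasurable_cst.
Qed.

Lemma cmeasurable_det r (F : T -> 'M[R[i]]_r) :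
  mxmeasurable P F -> cmeasurable P (fun p => \det (F p)).
Proof.
move=> mF; apply: cmeasurable_big => [f g|s]; first exact: cmeasurableD.
apply: cmeasurableM; first exact: cmeasurable_cst.
by apply: cmeasurable_big => [f g|k]; [exact: cmeasurableM|exact: mF].
Qed.

(** The case distinction in [invmx] is absorbed by [\det A * (\det A)^-1],
    which is the indicator of the invertible matrices. *)
Lemma mxmeasurable_inv r (F : T -> 'M[R[i]]_r) :
  mxmeasurable P F -> mxmeasurable P (fun p => invmx (F p)).
Proof.
move=> mF; have mdet := cmeasurable_det mF.
have -> : (fun p => invmx (F p)) = (fun p => (\det (F p))^-1 *: \adj (F p)
    + (1 + (-1) * (\det (F p) * (\det (F p))^-1)) *: F p).
  apply/funext => p; rewrite /invmx unitmxE unitfE.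
  have [->|d0] /= := eqVneq (\det (F p)) 0.
    by rewrite invr0 !(mul0r, mulr0, scale0r) addr0 scale1r add0r.
  by rewrite divff// mulr1 subrr scale0r addr0.
apply: mxmeasurableD; apply: mxmeasurableZ => //.
- exact: cmeasurableV.
- move=> i j; under eq_fun do rewrite mxE.
  apply: cmeasurableM; first exact: cmeasurable_cst.
  apply: cmeasurable_det => k l; under eq_fun do rewrite !mxE; exact: mF.
- apply: cmeasurableD; first exact: cmeasurable_cst.
  apply: cmeasurableM; first exact: cmeasurable_cst.
  by apply: cmeasurableM => //; exact: cmeasurableV.
Qed.

End Measurability.

(** * Integration under almost everywhere bounds *)

Section Integration.
Context {R : realType} {d : measure_display} {T : measurableType d}.
Variables (mu : {measure set T -> \bar R}) (P : set T).
Hypothesis mP : measurable P.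

Lemma ae_and (Q1 Q2 : T -> Prop) :
  {ae mu, forall p, P p -> Q1 p} -> {ae mu, forall p, P p -> Q2 p} ->
  {ae mu, forall p, P p -> Q1 p /\ Q2 p}.
Proof. by apply: filterS2 => p q1 q2 Pp; split; [exact: q1|exact: q2]. Qed.

Lemma ae_imp (Q1 Q2 : T -> Prop) : (forall p, P p -> Q1 p -> Q2 p) ->
  {ae mu, forall p, P p -> Q1 p} -> {ae mu, forall p, P p -> Q2 p}.
Proof. by move=> imp; apply: filterS => p q1 Pp; exact/imp/q1. Qed.

(** The integral of a nonnegative function is a supremum over the simple
    functions below it, so it is monotone without any measurability. *)
Lemma ge0_le_integral_nonmeasurable (f g : T -> \bar R) :
  (forall p, P p -> (0 <= f p)%E) -> (forall p, P p -> (f p <= g p)%E) ->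
  (\int[mu]_(p in P) f p <= \int[mu]_(p in P) g p)%E.
Proof.
move=> f0 fg; rewrite !ge0_integralE//; last first.
  by move=> p Pp; exact: le_trans (f0 _ Pp) (fg _ Pp).
apply: ereal_sup_le => _ [h hf <-]; exists h => // p.
by apply: le_trans (hf p) _; exact: lee_restrict.
Qed.

Lemma ae_le_integrable (f g : T -> R) : measurable_fun P f ->
  {ae mu, forall p, P p -> `|f p| <= g p} ->
  mu.-integrable P (EFin \o g) -> mu.-integrable P (EFin \o f).
Proof.
move=> mf fg /integrableP[/measurable_EFinP mg ig]; apply/integrableP; split.
  exact/measurable_EFinP.
apply: le_lt_trans ig; apply: ae_ge0_le_integral => //.
- by apply/measurable_EFinP; exact: measurableT_comp.
- by apply/measurable_EFinP; exact: measurableT_comp.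
- apply: ae_imp fg => p _ fg /=; rewrite lee_fin.
  exact: le_trans fg (ler_norm _).
Qed.

Lemma integrableDr (f g : T -> R) :
  mu.-integrable P (EFin \o f) -> mu.-integrable P (EFin \o g) ->
  mu.-integrable P (EFin \o (fun p => f p + g p)).
Proof. exact: integrableD. Qed.

Lemma integrableZr (c : R) (f : T -> R) :
  mu.-integrable P (EFin \o f) -> mu.-integrable P (EFin \o (fun p => c * f p)).
Proof. exact: integrableZl. Qed.

Lemma integral_EFin_Rintegral (f : T -> R) : mu.-integrable P (EFin \o f) ->
  (\int[mu]_(p in P) (f p)%:E)%E = (\int[mu]_(p in P) f p)%:E.
Proof.
by move=> intf; rewrite /Rintegral fineK//; exact: integrable_fin_num.
Qed.

Lemma measurable_mxdot m n (F D : T -> 'M[R[i]]_(m, n)) :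
  mxmeasurable P F -> mxmeasurable P D ->
  measurable_fun P (fun p => mxdot (F p) (D p)).
Proof.
move=> mF mD; under eq_fun do rewrite mxdotE.
apply: measurable_sum => i; apply: measurable_sum => j.
have [mF1 mF2] := mF i j; have [mD1 mD2] := mD i j.
by apply: measurable_funD; exact: measurable_funM.
Qed.

Lemma integrable_mxdot m n (F D : T -> 'M[R[i]]_(m, n)) (k1 k2 k : T -> R) :
  mxmeasurable P F -> mxmeasurable P D ->
  mu.-integrable P (EFin \o k) ->
  {ae mu, forall p, P p -> frobenius (F p) <= k1 p} ->
  {ae mu, forall p, P p -> frobenius (D p) <= k2 p} ->
  (forall p, k1 p * k2 p <= k p) ->
  mu.-integrable P (EFin \o (fun p => mxdot (F p) (D p))).
Proof.
move=> mF mD kint Fk Dk kk; apply: ae_le_integrable kint.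
  exact: measurable_mxdot.
apply: ae_imp (ae_and Fk Dk) => p _ [Fp Dp].
rewrite (le_trans (ler_norm_mxdot _ _))// (le_trans _ (kk p))//.
by apply: ler_pM => //; exact: frobenius_ge0.
Qed.

Lemma mxdotxx m n (F : 'M[R[i]]_(m, n)) : mxdot F F = frobenius F ^+ 2.
Proof.
rewrite mxdotE sqr_frobenius; apply: eq_bigr => i _; apply: eq_bigr => j _.
by rewrite sqr_cabs !expr2.
Qed.

Lemma linear_term_eq0 (b c t0 : R) : 0 < t0 -> 0 <= c ->
  (forall t, `|t| <= t0 -> 0 <= - (2 * t * b) + t ^+ 2 * c) -> b = 0.
Proof.
move=> t00 c0 H; apply/eqP; apply: contraT => b0.
have c1 : 0 < c + 1 by lra.
have nb : 0 < `|b| by rewrite normr_gt0.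
(* A step with the sign of [b], short enough for the linear term to win. *)
pose u := Num.min t0 (`|b| / (c + 1)).
have u0 : 0 < u by rewrite lt_min t00 divr_gt0.
have ut : u <= t0 by rewrite ge_min lexx.
have uc : u * (c + 1) <= `|b| by rewrite -ler_pdivlMr// ge_min lexx orbT.
have := H (Num.sg b * u).
rewrite normrM normr_sg b0 mul1r gtr0_norm// ut => /(_ isT).
rewrite (_ : _ + _ = u * (u * c - 2 * `|b|)); last first.
  by rewrite normrEsg exprMn sqr_sg b0 mul1r; ring.
rewrite pmulr_rge0// => ucb; nra.
Qed.

(** The variational core. Along a curve [Fam] leaving [F] with velocity [- D]
    the squared norm is at most
    [|F|^2 - 2 t <F, D> + t^2 (|D|^2 + 5 k^2)], pointwise and with one
    integrable coefficient for all small [t]; if [F] minimizes the integral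
    along the curve, the linear coefficient must vanish. The uniformity of the
    bound replaces differentiation under the integral sign. *)
Lemma stationary_mxdot m n (F D : T -> 'M[R[i]]_(m, n)) (k : T -> R)
    (Fam : R -> T -> 'M[R[i]]_(m, n)) (t0 : R) :
  mxmeasurable P F -> mxmeasurable P D ->
  mu.-integrable P (EFin \o (fun p => k p ^+ 2)) ->
  {ae mu, forall p, P p -> frobenius (F p) <= k p} ->
  {ae mu, forall p, P p -> frobenius (D p) <= k p} ->
  0 < t0 -> t0 <= 1 ->
  (forall t, `|t| <= t0 ->
    [/\ mxmeasurable P (Fam t),
        {ae mu, forall p, P p ->
           frobenius (Fam t p - (F p - t%:C *: D p)) <= t ^+ 2 * k p}
      & (\int[mu]_(p in P) (frobenius (F p) ^+ 2)%:E
          <= \int[mu]_(p in P) (frobenius (Fam t p) ^+ 2)%:E)%E]) ->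
  \int[mu]_(p in P) mxdot (F p) (D p) = 0.
Proof.
move=> mF mD k2 Fk Dk t00 t01 HFam.
have kk p : k p * k p <= k p ^+ 2 by rewrite expr2.
have iFF := integrable_mxdot mF mF k2 Fk Fk kk.
have iFD := integrable_mxdot mF mD k2 Fk Dk kk.
have iDD := integrable_mxdot mD mD k2 Dk Dk kk.
apply: (@linear_term_eq0 _ (\int[mu]_(p in P) mxdot (D p) (D p)
            + 5 * \int[mu]_(p in P) (k p ^+ 2)) t0) => //.
  rewrite addr_ge0// ?mulr_ge0//; apply: Rintegral_ge0 => p _.
    by rewrite mxdotxx sqr_ge0.
  exact: sqr_ge0.
move=> t tt0; have [mt at_ le_t] := HFam t tt0.
have t1 : `|t| <= 1 by exact: le_trans tt0 t01.
pose q p := mxdot (F p) (F p) + (- (2 * t)) * mxdot (F p) (D p)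
            + t ^+ 2 * (mxdot (D p) (D p) + 5 * k p ^+ 2).
have qE p : q p = frobenius (F p - t%:C *: D p) ^+ 2 + 5 * t ^+ 2 * k p ^+ 2.
  rewrite sqr_frobeniusD frobeniusN frobeniusZ cabs_real exprMn.
  rewrite real_normK ?num_real// /q !mxdotxx.
  rewrite (_ : - (t%:C *: D p) = (- t)%:C *: D p) ?mxdotZr; first by ring.
  by rewrite rmorphN scaleNr.
have i1 := integrableDr iFF (integrableZr (- (2 * t)) iFD).
have i2 := integrableDr iDD (integrableZr 5 k2).
have i3 := integrableZr (t ^+ 2) i2.
have iq : mu.-integrable P (EFin \o q) by exact: integrableDr i1 i3.
have le_q : (\int[mu]_(p in P) (frobenius (Fam t p) ^+ 2)%:E
    <= \int[mu]_(p in P) (q p)%:E)%E.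
  apply: ae_ge0_le_integral => //.
  - by move=> p _; rewrite lee_fin sqr_ge0.
  - by apply/measurable_EFinP; exact: measurable_sqr_frobenius.
  - move=> p _; rewrite lee_fin qE addr_ge0 ?sqr_ge0//.
    by rewrite mulr_ge0 ?sqr_ge0// mulr_ge0 ?sqr_ge0.
  - by have /integrableP[mq _] := iq.
  apply: ae_imp (ae_and at_ (ae_and Fk Dk)) => p _ [rp [Fp Dp]].
  rewrite lee_fin qE; set G := F p - _ in rp *.
  have GE : frobenius G <= 2 * k p.
    rewrite (le_trans (le_frobeniusD _ _))// frobeniusN frobeniusZ cabs_real.
    have := ler_pM (normr_ge0 t) (frobenius_ge0 (D p)) t1 Dp; lra.
  have : frobenius (Fam t p) <= frobenius G + t ^+ 2 * k p.
    rewrite -[Fam t p](subrK G) addrC.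
    by rewrite (le_trans (le_frobeniusD _ _))// lerD2l.
  have t2 : t ^+ 2 <= 1 by rewrite -(real_normK (num_real t)) expr_le1.
  have := frobenius_ge0 (Fam t p); have := frobenius_ge0 G.
  have k0 : 0 <= k p by exact: le_trans (frobenius_ge0 _) Fp.
  move: (sqr_ge0 t) t2 GE k0; move: (t ^+ 2) (k p) (frobenius G).
  move=> u x g u0 u1 gx x0 g0; set f := frobenius _ => f0 fgu.
  have ux : 0 <= u * x by rewrite mulr_ge0.
  have h1 : f ^+ 2 <= (g + u * x) ^+ 2 by rewrite ler_pXn2r// nnegrE addr_ge0.
  have h2 : g * (u * x) <= 2 * x * (u * x) by rewrite ler_wpM2r.
  have h3 : (u * x) ^+ 2 <= u * x ^+ 2.
    rewrite exprMn ler_wpM2r ?sqr_ge0// expr2 ler_piMr//.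
  by apply: le_trans h1 _; rewrite sqrrD; lra.
have := le_trans le_t le_q.
under [X in (X <= _)%E]eq_integral do rewrite -mxdotxx.
rewrite !integral_EFin_Rintegral// lee_fin /q.
rewrite (RintegralD mP i1 i3) (RintegralD mP iFF (integrableZr _ iFD)).
rewrite (RintegralZl _ mP i2) (RintegralD mP iDD (integrableZr _ k2)).
rewrite (RintegralZl _ mP iFD) (RintegralZl _ mP k2).
move: (Rintegral mu P _) => x; move: (Rintegral mu P _) => y.
move: (Rintegral mu P _) => z; move: (Rintegral mu P _) => v; lra.
Qed.

(** Each direction [E] controls one real coordinate of the compressed matrix,
    so stationarity along curves in all directions gives the full equation.
    The curves may have a quadratic remainder, which is where the nonlinear
    dependence of the output on the model goes. *)
Lemma eq_mxintegral_of_stationary a b m n (w : T -> R[i])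
    (U : T -> 'M[R[i]]_(m, a)) (V : T -> 'M[R[i]]_(b, n))
    (H Hh : T -> 'M[R[i]]_(m, n)) (k : T -> R) :
  cmeasurable P w -> mxmeasurable P U -> mxmeasurable P V ->
  mxmeasurable P H -> mxmeasurable P Hh ->
  mu.-integrable P (EFin \o (fun p => k p ^+ 2)) ->
  {ae mu, forall p, P p -> frobenius (H p) <= k p} ->
  {ae mu, forall p, P p -> frobenius (Hh p) <= k p} ->
  {ae mu, forall p, P p ->
    cabs (w p) * (frobenius (U p) * frobenius (V p)) <= k p} ->
  (forall E : 'M[R[i]]_(a, b),
    exists (K t0 : R) (Fam : R -> T -> 'M[R[i]]_(m, n)),
    [/\ 0 <= K, 0 < t0
      & forall t, `|t| <= t0 ->
        [/\ mxmeasurable P (Fam t),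
            {ae mu, forall p, P p ->
               frobenius (Fam t p - (Hh p + t%:C *: (w p *: (U p *m E *m V p))))
                 <= t ^+ 2 * (K * k p)}
          & (\int[mu]_(p in P) (frobenius (H p - Hh p) ^+ 2)%:E
              <= \int[mu]_(p in P) (frobenius (H p - Fam t p) ^+ 2)%:E)%E]]) ->
  eq_mxintegral mu P
    (fun p => (w p)^* *: ((U p)^t* *m H p *m (V p)^t*))
    (fun p => (w p)^* *: ((U p)^t* *m Hh p *m (V p)^t*)).
Proof.
move=> mw mU mV mH mHh k2 Hk Hhk wk stat.
pose D E p := w p *: (U p *m E *m V p).
have mD E : mxmeasurable P (D E).
  apply: mxmeasurableZ => //; apply: mxmeasurableM => //.
  by apply: mxmeasurableM => //; exact: mxmeasurable_cst.
have Dk E : {ae mu, forall p, P p -> frobenius (D E p) <= frobenius E * k p}.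
  apply: ae_imp wk => p _ wp; rewrite frobeniusZ.
  apply: le_trans (ler_wpM2l (frobenius_ge0 E) wp).
  rewrite mulrCA ler_wpM2l ?cabs_ge0//.
  apply: le_trans (le_frobeniusM _ _) _; rewrite mulrCA mulrA.
  by rewrite ler_wpM2r ?frobenius_ge0// mulrC mulrC le_frobeniusM.
have iD E G : mxmeasurable P G ->
    {ae mu, forall p, P p -> frobenius (G p) <= k p} ->
    mu.-integrable P (EFin \o (fun p => mxdot (G p) (D E p))).
  move=> mG Gk.
  apply: integrable_mxdot (integrableZr (frobenius E) k2) Gk (Dk E) _ => //.
  by move=> p; rewrite mulrCA expr2.
have dotE E : \int[mu]_(p in P) mxdot (H p) (D E p)
    = \int[mu]_(p in P) mxdot (Hh p) (D E p).
  apply/eqP; rewrite -subr_eq0 -RintegralB//; [|exact: iD|exact: iD].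
  under eq_Rintegral do rewrite -mxdotBl.
  have [K [t0 [Fam [K0 t00 HFam]]]] := stat E.
  (* One constant for all three bounds: [2] for [H - Hh], [frobenius E] for
     the velocity, [K] for the remainder. *)
  pose c := 2 + K + frobenius E.
  have cE : c = 2 + K + frobenius E by [].
  have E0 := frobenius_ge0 E.
  apply/eqP; apply: (@stationary_mxdot _ _ _ _ (fun p => c * k p)
    (fun t p => H p - Fam t p) (Num.min t0 1)).
  - exact: mxmeasurableB.
  - exact: mD.
  - under eq_fun do rewrite exprMn.
    exact: integrableZr.
  - apply: ae_imp (ae_and Hk Hhk) => p _ [Hp Hhp].
    rewrite (le_trans (le_frobeniusD _ _))// frobeniusN.
    have := frobenius_ge0 (H p); nra.
  - apply: ae_imp (ae_and Hk (Dk E)) => p _ [Hp Dp].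
    have := frobenius_ge0 (H p); nra.
  - by rewrite lt_min t00 ltr01.
  - by rewrite ge_min lexx orbT.
  move=> t; rewrite le_min => /andP[tt0 _].
  have [mFam rFam lFam] := HFam t tt0; split => //.
    exact: mxmeasurableB.
  apply: ae_imp (ae_and Hk rFam) => p _ [Hp rp].
  rewrite -frobeniusN (_ : - _ = Fam t p - (Hh p + t%:C *: D E p)); last first.
    by rewrite 2!opprB addrC -!addrA addKr opprD.
  apply: le_trans rp _; rewrite ler_wpM2l ?sqr_ge0//.
  have := frobenius_ge0 (H p); nra.
have ReE G i j p :
    complex.Re (((w p)^* *: ((U p)^t* *m G p *m (V p)^t*)) i j)
      = mxdot (G p) (D (1 *: delta_mx i j) p).
  by rewrite mxdot_delta rmorph1 mul1r.
have ImE G i j p :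
    complex.Im (((w p)^* *: ((U p)^t* *m G p *m (V p)^t*)) i j)
      = mxdot (G p) (D ('i%C *: delta_mx i j) p).
  by rewrite mxdot_delta; case: (_ i j) => x y /=; ring.
split.
- move=> i j; split.
    by under eq_fun do rewrite ReE; exact: iD.
  by under eq_fun do rewrite ImE; exact: iD.
- move=> i j; split.
    by under eq_fun do rewrite ReE; exact: iD.
  by under eq_fun do rewrite ImE; exact: iD.
have eqE (g : R[i] -> R) i j z : (forall G p,
    g (((w p)^* *: ((U p)^t* *m G p *m (V p)^t*)) i j)
      = mxdot (G p) (D (z *: delta_mx i j) p)) ->
    \int[mu]_(p in P) g (((w p)^* *: ((U p)^t* *m H p *m (V p)^t*)) i j)
    = \int[mu]_(p in P) g (((w p)^* *: ((U p)^t* *m Hh p *m (V p)^t*)) i j).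
  move=> gE.
  transitivity (\int[mu]_(p in P) mxdot (H p) (D (z *: delta_mx i j) p)).
    by apply: eq_Rintegral => p _; exact: gE.
  by rewrite dotE; apply: eq_Rintegral => p _; rewrite gE.
apply/matrixP => i j; rewrite [LHS]mxE [RHS]mxE.
apply: (f_equal2 (@Complex R)); apply: eqE => G p; [exact: ReE|exact: ImE].
Qed.

End Integration.

(** * Structured reduced-order models *)

Section Strom.
Context {R : realType} {d : measure_display} {T : measurableType d}.
Variables (mu : {measure set T -> \bar R}) (P : set T) (mP : measurable P).
Variables (no ni r qA qB qC : nat).
Hypothesis r_gt0 : (0 < r)%N.
Variables (alpha : 'I_qA -> T -> R[i]) (beta : 'I_qB -> T -> R[i]).
Variable gamma : 'I_qC -> T -> R[i].
Hypothesis malpha : forall i, cmeasurable P (alpha i).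
Hypothesis mbeta : forall j, cmeasurable P (beta j).
Hypothesis mgamma : forall k, cmeasurable P (gamma k).
Implicit Types s : strom R r ni no qA qB qC.

Let absA p : R := \sum_i cabs (alpha i p).
Let absB p : R := \sum_j cabs (beta j p).
Let absC p : R := \sum_k cabs (gamma k p).
Let iA s p := invmx (sepform alpha (Amx s) p).

Let absA_ge0 p : 0 <= absA p.
Proof. by apply: sumr_ge0 => *; exact: cabs_ge0. Qed.
Let absB_ge0 p : 0 <= absB p.
Proof. by apply: sumr_ge0 => *; exact: cabs_ge0. Qed.
Let absC_ge0 p : 0 <= absC p.
Proof. by apply: sumr_ge0 => *; exact: cabs_ge0. Qed.

Lemma le_sum_cabs (S : Type) q (w : 'I_q -> S -> R[i]) i p :
  cabs (w i p) <= \sum_l cabs (w l p).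
Proof.
rewrite (bigD1 i)//= lerDl; apply: sumr_ge0 => *; exact: cabs_ge0.
Qed.

(** The weight whose square integrability is assumed: it dominates all the
    quantities built from a model of [SigmaSt]. *)
Definition strom_weight p : R := absB p * absC p / absA p.

Lemma strom_weight_ge0 p : 0 <= strom_weight p.
Proof. by rewrite divr_ge0// mulr_ge0. Qed.

Lemma measurable_strom_weight : measurable_fun P strom_weight.
Proof.
apply: measurable_funM.
  apply: measurable_funM; apply: measurable_sum => i;
  exact: measurable_cabs.
by apply: measurable_fun_ge0V => //; apply: measurable_sum => i;
  exact: measurable_cabs.
Qed.

(** The extended quotient is at least the real one: they differ only where
    the denominator vanishes, and there the real quotient is [0]. *)
Lemma integrable_sqr_strom_weight :
  (\int[mu]_(p in P) ((((\sum_(j < qB) cabs (beta j p))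
      * (\sum_(k < qC) cabs (gamma k p)))%R%:E
        / (\sum_(i < qA) cabs (alpha i p))%R%:E) ^+ 2) < +oo)%E ->
  mu.-integrable P (EFin \o (fun p => strom_weight p ^+ 2)).
Proof.
move=> habc; apply/integrableP; split.
  apply/measurable_EFinP; apply: measurable_funX.
  exact: measurable_strom_weight.
apply: le_lt_trans habc; apply: ge0_le_integral_nonmeasurable => //= p Pp.
rewrite ger0_norm ?sqr_ge0// -expe2 -/(absA p) -/(absB p) -/(absC p).
have [a0|a0] := eqVneq (absA p) 0.
  rewrite /strom_weight a0 invr0 mulr0 expr0n; apply: expe_ge0.
  apply: mule_ge0; first by rewrite lee_fin mulr_ge0.
  by rewrite inve_ge0 lee_fin.
by rewrite inver (negbTE a0) -EFinM -EFin_expe.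
Qed.

Lemma ae_mrestr (Q : T -> Prop) :
  {ae mrestr mu mP, forall p, Q p} <-> {ae mu, forall p, P p -> Q p}.
Proof.
split=> -[B [mB B0 QB]].
  exists (B `&` P); split => //; first exact: measurableI.
  by move=> p /= /not_implyP[Pp nQ]; split => //; exact: QB.
exists (B `|` ~` P); split.
- by apply: measurableU => //; exact: measurableC.
- apply: (subset_measure0 _ _ _ B0) => //=.
    apply: measurableI => //.
    by apply: measurableU => //; exact: measurableC.
  by move=> p /= [[]].
- move=> p /= nQ; have [Pp|] := pselect (P p); last by right.
  by left; apply: QB => /(_ Pp).
Qed.

Lemma SigmaStP s : SigmaSt mu mP alpha s <->
  exists M, {ae mu, forall p, P p -> sepform alpha (Amx s) p \in unitmx
    /\ forall i, cabs (alpha i p) * frobenius (iA s p) <= M}.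
Proof.
split=> [[Au ess]|[M AM]]; last first.
  split=> [|i]; first by apply: ae_imp AM => p _ [].
  apply: (@le_lt_trans _ _ M%:E); last exact: ltry.
  apply/ess_supP/ae_mrestr; apply: ae_imp AM => p _ [_ /(_ i)].
  by rewrite lee_fin frobeniusZ.
pose N i p := (frobenius (alpha i p *: iA s p))%:E.
have le_ess i := iffLR (ae_mrestr _) (ess_sup_ge (mrestr mu mP) (N i)).
have bnd i : exists M, {ae mu, forall p, P p ->
    cabs (alpha i p) * frobenius (iA s p) <= M}.
  have [e|e] := ltP (ess_sup (mrestr mu mP) (N i)) 0%E.
    exists 0; apply: ae_imp (le_ess i) => p _ /le_lt_trans/(_ e)/ltW.
    by rewrite lee_fin frobeniusZ.
  have fin_e : ess_sup (mrestr mu mP) (N i) \is a fin_num.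
    by rewrite ge0_fin_numE//; exact: ess.
  exists (fine (ess_sup (mrestr mu mP) (N i))).
  apply: ae_imp (le_ess i) => p _.
  by rewrite -[X in (_ <= X)%E](fineK fin_e) lee_fin frobeniusZ.
have [M MP] := choice bnd; exists (\sum_i `|M i|).
have all_i : {ae mu, forall p, forall i : 'I_qA, P p ->
    cabs (alpha i p) * frobenius (iA s p) <= M i}.
  apply: filter_forall => i; exact: MP.
apply: filterS2 Au all_i => p Au al Pp; split=> [|i]; first exact: Au.
rewrite (le_trans (al i Pp))// (le_trans (ler_norm _))//.
by rewrite (bigD1 i)//= lerDl sumr_ge0.
Qed.

(** Summing the bounds on [alpha i * A(p)^-1] over [i] turns them into
    [|A(p)^-1| <= M / sum_i |alpha i|]; the sum is nonzero because [A(p)] is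
    invertible of positive size. *)
Lemma SigmaSt_bound s : SigmaSt mu mP alpha s -> exists2 M, 0 <= M &
  {ae mu, forall p, P p -> [/\ sepform alpha (Amx s) p \in unitmx,
    forall i, cabs (alpha i p) * frobenius (iA s p) <= M
    & absB p * absC p * frobenius (iA s p) <= M * strom_weight p]}.
Proof.
move=> /SigmaStP[M AM]; exists ((qA%:R + 1) * `|M|).
  by rewrite mulr_ge0 ?addr_ge0.
apply: ae_imp AM => p _ [Au AM]; split=> // [i|].
  by rewrite (le_trans (AM i))// (le_trans (ler_norm M))// ler_peMl// lerDr.
have absA_gt0 : 0 < absA p.
  rewrite lt0r absA_ge0 andbT; apply/eqP => a0.
  have A0 : sepform alpha (Amx s) p = 0.
    apply: frobenius_eq0; apply/eqP; rewrite eq_le frobenius_ge0 andbT.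
    by rewrite (le_trans (le_frobenius_sepform _ _ _))// -/(absA p) a0 mul0r.
  have /matrixP/(_ (Ordinal r_gt0) (Ordinal r_gt0)) := mulmxV Au.
  by rewrite A0 mul0mx !mxE eqxx => /esym/eqP; rewrite oner_eq0.
rewrite /strom_weight mulrCA ler_wpM2l ?mulr_ge0// ler_pdivlMr// mulrC.
rewrite mulr_suml (@le_trans _ _ (\sum_(i < qA) `|M|))//.
  by apply: ler_sum => i _; rewrite (le_trans (AM i))// ler_norm.
by rewrite sumr_const card_ord -[_ *+ qA]mulr_natl ler_wpM2r// lerDl.
Qed.

Lemma mxmeasurable_iA s : mxmeasurable P (iA s).
Proof. by apply: mxmeasurable_inv; exact: mxmeasurable_sepform. Qed.

Lemma mxmeasurable_redX s : mxmeasurable P (redX alpha beta s).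
Proof.
apply: mxmeasurableM; first exact: mxmeasurable_iA.
exact: mxmeasurable_sepform.
Qed.

Lemma mxmeasurable_redH s : mxmeasurable P (redH alpha beta gamma s).
Proof.
apply: mxmeasurableM; last exact: mxmeasurable_redX.
exact: mxmeasurable_sepform.
Qed.

Lemma sepform_perturb q m n (w : 'I_q -> T -> R[i])
    (M : 'I_q -> 'M[R[i]]_(m, n)) l E p :
  sepform w (fun l' => M l' + (if l' == l then E else 0)) p
    = sepform w M p + w l p *: E.
Proof.
rewrite /sepform; under eq_bigr do rewrite scalerDr.
rewrite big_split/=; congr (_ + _); rewrite (bigD1 l)//= eqxx big1 ?addr0//.
by move=> j /negbTE ->; rewrite scaler0.
Qed.

Section Optimal.
Variables (H : T -> 'M[R[i]]_(no, ni)) (s : strom R r ni no qA qB qC).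
Hypothesis HL2 : mxL2 mu P H.
Hypothesis iweight : mu.-integrable P (EFin \o (fun p => strom_weight p ^+ 2)).
Hypothesis hopt : L2_optimal mu P alpha beta gamma H (SigmaSt mu mP alpha) s.

Let A p := sepform alpha (Amx s) p.
Let B p := sepform beta (Bmx s) p.
Let C p := sepform gamma (Cmx s) p.
Let cB : R := \sum_j frobenius (Bmx s j).
Let cC : R := \sum_k frobenius (Cmx s k).

Let cB_ge0 : 0 <= cB.
Proof. by apply: sumr_ge0 => *; exact: frobenius_ge0. Qed.
Let cC_ge0 : 0 <= cC.
Proof. by apply: sumr_ge0 => *; exact: frobenius_ge0. Qed.

(** One square-integrable function dominating, up to constants, the data, the
    output and the output variations; it decouples the estimates on single
    points from the variational argument. *)
Let h p : R := frobenius (H p) + strom_weight p.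

Let h_ge0 p : 0 <= h p.
Proof. by rewrite addr_ge0 ?frobenius_ge0 ?strom_weight_ge0. Qed.

Lemma integrable_sqr_dominating K :
  mu.-integrable P (EFin \o (fun p => (K * h p) ^+ 2)).
Proof.
have mHs := measurable_sqr_frobenius HL2.1.
have iH : mu.-integrable P (EFin \o (fun p => frobenius (H p) ^+ 2)).
  apply/integrableP; split; first exact/measurable_EFinP.
  apply: le_lt_trans HL2.2; rewrite le_eqVlt; apply/orP; left; apply/eqP.
  by apply: eq_integral => p _ /=; rewrite ger0_norm ?sqr_ge0.
have i1 := integrableZr mP (2 * K ^+ 2) (integrableDr mP iH iweight).
apply: (ae_le_integrable mP) i1.
  apply: measurable_funX; apply: measurable_funM => //.
  apply: measurable_funD; last exact: measurable_strom_weight.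
  exact: measurable_frobenius HL2.1.
apply: nearW => p _; rewrite ger0_norm ?sqr_ge0// exprMn /h /=.
move: (frobenius _) (strom_weight p) => a b.
have := mulr_ge0 (sqr_ge0 K) (sqr_ge0 (a - b)); lra.
Qed.

(** The estimates on the output and on the three kinds of velocity: each is a
    constant times [absB * absC * |A^-1|], hence a constant times the weight;
    for [alpha] the second factor [A^-1] is absorbed by [|alpha i A^-1| <= M].
    A common constant [K] serves all of them. *)
Lemma pointwise_bounds : exists M K : R, 0 <= M /\ 1 <= K /\
  {ae mu, forall p, P p -> [/\ A p \in unitmx,
     forall i, cabs (alpha i p) * frobenius (iA s p) <= M,
     frobenius (C p) * frobenius (iA s p) * frobenius (B p) <= K * h p,
     forall k, cabs (gamma k p) * (frobenius (1%:M : 'M[R[i]]_no)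
       * frobenius (redX alpha beta s p)) <= K * h p
   & (forall j, cabs (beta j p) * (frobenius (C p *m iA s p)
       * frobenius (1%:M : 'M[R[i]]_ni)) <= K * h p) /\
     forall i, cabs (alpha i p) * (frobenius (C p *m iA s p)
       * frobenius (redX alpha beta s p)) <= K * h p]}.
Proof.
have [M M0 AM] := SigmaSt_bound hopt.1.
pose n1 := frobenius (1%:M : 'M[R[i]]_no).
pose n2 := frobenius (1%:M : 'M[R[i]]_ni).
have n10 : 0 <= n1 by exact: frobenius_ge0.
have n20 : 0 <= n2 by exact: frobenius_ge0.
have k1 : 0 <= cC * cB * M by rewrite !mulr_ge0.
have k2 : 0 <= n1 * cB * M by rewrite !mulr_ge0.
have k3 : 0 <= n2 * cC * M by rewrite !mulr_ge0.
have k4 : 0 <= cC * cB * M * M by rewrite !mulr_ge0.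
exists M, (1 + cC * cB * M + n1 * cB * M + n2 * cC * M + cC * cB * M * M).
split => //; split; first lra.
apply: ae_imp AM => p _ [Au AM]; set K := (1 + _ + _ + _ + _).
rewrite -/(iA s p); set a := frobenius (iA s p) => wa.
have a0 : 0 <= a by exact: frobenius_ge0.
have Kh c x : 0 <= c -> c * M <= K -> x <= c * (absB p * absC p * a) ->
    x <= K * h p.
  move=> c0 cK /le_trans; apply; rewrite (le_trans (ler_wpM2l c0 wa))// mulrA.
  apply: ler_pM => //; [exact: mulr_ge0|exact: strom_weight_ge0|].
  by rewrite lerDr frobenius_ge0.
have lB : frobenius (B p) <= absB p * cB by exact: le_frobenius_sepform.
have lC : frobenius (C p) <= absC p * cC by exact: le_frobenius_sepform.
have lX : frobenius (redX alpha beta s p) <= a * (absB p * cB).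
  by rewrite (le_trans (le_frobeniusM _ _))// ler_wpM2l.
have lU : frobenius (C p *m iA s p) <= absC p * cC * a.
  by rewrite (le_trans (le_frobeniusM _ _))// ler_wpM2r.
have fge0 m n (Y : 'M[R[i]]_(m, n)) : 0 <= frobenius Y := frobenius_ge0 Y.
split=> //.
- apply: (Kh (cC * cB)); [exact: mulr_ge0|rewrite /K; lra|].
  apply: (@le_trans _ _ (absC p * cC * a * (absB p * cB))).
    by apply: ler_pM => //; [exact: mulr_ge0|exact: ler_wpM2r].
  by rewrite le_eqVlt; apply/orP; left; apply/eqP; ring.
- move=> k; apply: (Kh (n1 * cB)); [exact: mulr_ge0|rewrite /K; lra|].
  apply: (@le_trans _ _ (absC p * (n1 * (a * (absB p * cB))))).
    apply: ler_pM => //; [exact: cabs_ge0|exact: mulr_ge0| |].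
      exact: le_sum_cabs.
    exact: ler_wpM2l.
  by rewrite le_eqVlt; apply/orP; left; apply/eqP; ring.
split=> [j|i].
- apply: (Kh (n2 * cC)); [exact: mulr_ge0|rewrite /K; lra|].
  apply: (@le_trans _ _ (absB p * (absC p * cC * a * n2))).
    apply: ler_pM => //; [exact: cabs_ge0|exact: mulr_ge0| |].
      exact: le_sum_cabs.
    exact: ler_wpM2r.
  by rewrite le_eqVlt; apply/orP; left; apply/eqP; ring.
- apply: (Kh (cC * cB * M)); [by rewrite !mulr_ge0|rewrite /K; lra|].
  apply: (@le_trans _ _ (cabs (alpha i p)
      * (absC p * cC * a * (a * (absB p * cB))))).
    by rewrite ler_wpM2l ?cabs_ge0//; exact: ler_pM.
  rewrite (_ : _ * _ = (cabs (alpha i p) * a)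
    * (cC * cB * (absB p * absC p * a))); last by ring.
  rewrite (_ : cC * cB * M * _ = M * (cC * cB * (absB p * absC p * a))).
    by rewrite ler_wpM2r// !mulr_ge0.
  by ring.
Qed.

Lemma redH_bound K : {ae mu, forall p, P p ->
    frobenius (C p) * frobenius (iA s p) * frobenius (B p) <= K * h p} ->
  {ae mu, forall p, P p -> frobenius (redH alpha beta gamma s p) <= K * h p}.
Proof.
apply: ae_imp => p _; apply: le_trans.
rewrite (le_trans (le_frobeniusM _ _))// -mulrA ler_wpM2l ?frobenius_ge0//.
exact: le_frobeniusM.
Qed.

Let adjmx1 n : (1%:M : 'M[R[i]]_n)^t* = 1%:M.
Proof. by rewrite trmx1 map_mx1. Qed.

(** The shared part of the three conditions: only the curve of competitors
    and its velocity [w *: (U *m E *m V)] differ. *)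
Lemma first_order_condition a b (w : T -> R[i]) (U : T -> 'M[R[i]]_(no, a))
    (V : T -> 'M[R[i]]_(b, ni)) (K : R) :
  cmeasurable P w -> mxmeasurable P U -> mxmeasurable P V -> 1 <= K ->
  {ae mu, forall p, P p ->
    frobenius (C p) * frobenius (iA s p) * frobenius (B p) <= K * h p} ->
  {ae mu, forall p, P p ->
    cabs (w p) * (frobenius (U p) * frobenius (V p)) <= K * h p} ->
  (forall E : 'M[R[i]]_(a, b),
    exists (L t0 : R) (st : R -> strom R r ni no qA qB qC),
    [/\ 0 <= L, 0 < t0 & forall t, `|t| <= t0 ->
      SigmaSt mu mP alpha (st t) /\
      {ae mu, forall p, P p -> frobenius (redH alpha beta gamma (st t) p
         - (redH alpha beta gamma s p
              + t%:C *: (w p *: (U p *m E *m V p))))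
         <= t ^+ 2 * (L * (K * h p))}]) ->
  eq_mxintegral mu P
    (fun p => (w p)^* *: ((U p)^t* *m H p *m (V p)^t*))
    (fun p => (w p)^* *: ((U p)^t* *m redH alpha beta gamma s p *m (V p)^t*)).
Proof.
move=> mw mU mV K1 Hb wb curve.
apply: (eq_mxintegral_of_stationary mP (k := fun p => K * h p)) => //.
- exact: HL2.1.
- exact: mxmeasurable_redH.
- exact: integrable_sqr_dominating.
- apply: nearW => p _; rewrite (@le_trans _ _ (h p))//.
    by rewrite lerDl strom_weight_ge0.
  by rewrite ler_peMl.
- exact: redH_bound.
move=> E; have [L [t0 [st [L0 t00 stP]]]] := curve E.
exists L, t0, (fun t => redH alpha beta gamma (st t)).
split; [exact: L0|exact: t00|move=> t tt0].
have [Ss rem] := stP t tt0; split; [exact: mxmeasurable_redH|exact: rem|].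
exact: hopt.2 _ Ss.
Qed.

Lemma optimality_C k : eq_mxintegral mu P
  (fun p => (gamma k p)^* *: (H p *m (redX alpha beta s p)^t*))
  (fun p => (gamma k p)^* *:
     (redH alpha beta gamma s p *m (redX alpha beta s p)^t*)).
Proof.
have [M [K [M0 [K1 bnd]]]] := pointwise_bounds.
have E1 (G : T -> 'M[R[i]]_(no, ni)) :
    (fun p => (gamma k p)^* *: (G p *m (redX alpha beta s p)^t*))
  = (fun p => (gamma k p)^* *:
      ((1%:M : 'M[R[i]]_no)^t* *m G p *m (redX alpha beta s p)^t*)).
  by apply/funext => p; rewrite adjmx1 mul1mx.
rewrite (E1 H) (E1 (redH alpha beta gamma s)).
have mX := mxmeasurable_redX s.
have mU := mxmeasurable_cst P (1%:M : 'M[R[i]]_no).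
apply: (first_order_condition (mgamma k) mU mX K1).
- by apply: ae_imp bnd => p _ [].
- by apply: ae_imp bnd => p _ [].
move=> E; exists 0, 1, (fun t => StROM (Amx s) (Bmx s)
  (fun l => Cmx s l + (if l == k then t%:C *: E else 0))).
split=> // t _; split; first exact: hopt.1.
apply: nearW => p _.
rewrite /redH/= sepform_perturb mul1mx mulmxDl -scalemxAl !scalerA.
rewrite -scalemxAl scalerA [t%:C * _]mulrC subrr.
by rewrite mul0r mulr0 -[0](scale0r 0) frobeniusZ cabs0 mul0r.
Qed.

Lemma optimality_B j : eq_mxintegral mu P
  (fun p => (beta j p)^* *: (redXd alpha gamma s p *m H p))
  (fun p => (beta j p)^* *:
     (redXd alpha gamma s p *m redH alpha beta gamma s p)).
Proof.
have [M [K [M0 [K1 bnd]]]] := pointwise_bounds.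
have E1 (G : T -> 'M[R[i]]_(no, ni)) :
    (fun p => (beta j p)^* *: (redXd alpha gamma s p *m G p))
  = (fun p => (beta j p)^* *:
      ((C p *m iA s p)^t* *m G p *m (1%:M : 'M[R[i]]_ni)^t*)).
  by apply/funext => p; rewrite adjmx1 mulmx1 adjmxM.
rewrite (E1 H) (E1 (redH alpha beta gamma s)).
have mU := mxmeasurableM (mxmeasurable_sepform (Cmx s) mgamma)
  (mxmeasurable_iA s).
have mV := mxmeasurable_cst P (1%:M : 'M[R[i]]_ni).
apply: (first_order_condition (mbeta j) mU mV K1).
- by apply: ae_imp bnd => p _ [].
- by apply: ae_imp bnd => p _ [_ _ _ _ []].
move=> E; exists 0, 1, (fun t => StROM (Amx s)
  (fun l => Bmx s l + (if l == j then t%:C *: E else 0)) (Cmx s)).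
split=> // t _; split; first exact: hopt.1.
apply: nearW => p _.
rewrite /redH /redX/= sepform_perturb mulmx1 !mulmxDr -!scalemxAr -/(iA s p).
rewrite !mulmxA !scalerA [t%:C * _]mulrC subrr.
by rewrite mul0r mulr0 -[0](scale0r 0) frobeniusZ cabs0 mul0r.
Qed.

(** Perturbing [A_i] by [- t E] multiplies [A] on the right by [1 - N] with
    [N = t alpha_i A^-1 E], which is uniformly small because [alpha_i A^-1] is
    essentially bounded; two steps of the Neumann series give the velocity
    [alpha_i C A^-1 E A^-1 B] and a remainder of order [t^2]. *)
Lemma optimality_A i : eq_mxintegral mu P
  (fun p => (alpha i p)^* *:
     (redXd alpha gamma s p *m H p *m (redX alpha beta s p)^t*))
  (fun p => (alpha i p)^* *:
     (redXd alpha gamma s p *m redH alpha beta gamma s p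
        *m (redX alpha beta s p)^t*)).
Proof.
have [M [K [M0 [K1 bnd]]]] := pointwise_bounds.
have E1 (G : T -> 'M[R[i]]_(no, ni)) :
    (fun p => (alpha i p)^* *:
       (redXd alpha gamma s p *m G p *m (redX alpha beta s p)^t*))
  = (fun p => (alpha i p)^* *:
      ((C p *m iA s p)^t* *m G p *m (redX alpha beta s p)^t*)).
  by apply/funext => p; rewrite adjmxM.
rewrite (E1 H) (E1 (redH alpha beta gamma s)).
have mX := mxmeasurable_redX s.
have mU := mxmeasurableM (mxmeasurable_sepform (Cmx s) mgamma)
  (mxmeasurable_iA s).
apply: (first_order_condition (malpha i) mU mX K1).
- by apply: ae_imp bnd => p _ [].
- by apply: ae_imp bnd => p _ [_ _ _ _ []].
move=> E; have E0 := frobenius_ge0 E.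
have ME0 : 0 <= M * frobenius E by exact: mulr_ge0.
pose st t := StROM
  (fun l => Amx s l + (if l == i then (- t)%:C *: E else 0)) (Bmx s) (Cmx s).
(* This step length makes [|N| <= 1/2] below. *)
exists (2 * (M * frobenius E) ^+ 2), (2 * (M * frobenius E + 1))^-1, st.
split=> [||t tt0].
- by rewrite mulr_ge0 ?sqr_ge0.
- by rewrite invr_gt0 mulr_gt0// ltr_wpDl.
pose N p := t%:C *: (alpha i p *: (iA s p *m E)).
have NM p : cabs (alpha i p) * frobenius (iA s p) <= M ->
    frobenius (N p) <= `|t| * (M * frobenius E).
  move=> aM; rewrite !frobeniusZ cabs_real ler_wpM2l//.
  apply: le_trans (ler_wpM2r E0 aM); rewrite -mulrA ler_wpM2l ?cabs_ge0//.
  exact: le_frobeniusM.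
have tME : `|t| * (M * frobenius E) <= 2^-1.
  have g0 : 0 < 2 * (M * frobenius E + 1) by rewrite mulr_gt0// ltr_wpDl.
  by move: tt0; rewrite -[_^-1]mul1r ler_pdivlMr//; have := normr_ge0 t; lra.
have pert p : A p \in unitmx -> cabs (alpha i p) * frobenius (iA s p) <= M ->
    [/\ sepform alpha (Amx (st t)) p \in unitmx,
      iA (st t) p = iA s p + N p *m iA (st t) p
    & frobenius (iA (st t) p) <= 2 * frobenius (iA s p)].
  move=> Au aM; apply: (perturbed_invmx Au _ (le_trans (NM p aM) tME)).
  rewrite sepform_perturb mulmxBr mulmx1 /N -!scalemxAr mulmxA mulmxV//.
  by rewrite mul1mx scalerA rmorphN mulrN scaleNr scalerA mulrC.
split.
  apply/SigmaStP; exists (2 * M); apply: ae_imp bnd => p _ [Au aM _ _ _].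
  have [A'u _ A'le] := pert p Au (aM i); split=> // l.
  apply: le_trans (ler_wpM2l (cabs_ge0 _) A'le) _.
  by rewrite mulrCA ler_wpM2l.
apply: ae_imp bnd => p _ [Au aM Kh _ _].
have [_ YE Yle] := pert p Au (aM i).
have -> : redH alpha beta gamma (st t) p - (redH alpha beta gamma s p
    + t%:C *: (alpha i p *: (C p *m iA s p *m E *m redX alpha beta s p)))
    = C p *m (N p *m (N p *m iA (st t) p)) *m B p.
  have -> : redH alpha beta gamma (st t) p = C p *m (iA (st t) p *m B p) by [].
  have -> : redH alpha beta gamma s p = C p *m (iA s p *m B p) by [].
  have -> : t%:C *: (alpha i p *: (C p *m iA s p *m E *m redX alpha beta s p))
      = C p *m (N p *m iA s p *m B p).
    by rewrite /N -?(scalemxAl, scalemxAr) /redX !mulmxA.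
  have Ya : iA (st t) p - iA s p = N p *m iA (st t) p.
    by rewrite {1}YE addrAC subrr add0r.
  rewrite -mulmxDr -mulmxBr -mulmxDl -mulmxBl opprD addrA Ya -mulmxBr Ya.
  by rewrite !mulmxA.
have f0 m n (Y : 'M[R[i]]_(m, n)) : 0 <= frobenius Y := frobenius_ge0 Y.
apply: le_trans (le_frobeniusM _ _) _.
apply: (@le_trans _ _ (frobenius (C p)
    * ((`|t| * (M * frobenius E)) ^+ 2 * (2 * frobenius (iA s p)))
    * frobenius (B p))).
  rewrite ler_wpM2r//; apply: le_trans (le_frobeniusM _ _) _.
  rewrite ler_wpM2l//; apply: le_trans (le_frobeniusM _ _) _.
  rewrite expr2 -mulrA; apply: ler_pM => //; first exact: NM.
  apply: le_trans (le_frobeniusM _ _) _.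
  by apply: ler_pM => //; exact: NM.
rewrite exprMn real_normK ?num_real//.
rewrite (_ : _ * frobenius (B p) = t ^+ 2 * (2 * (M * frobenius E) ^+ 2
  * (frobenius (C p) * frobenius (iA s p) * frobenius (B p)))); last by ring.
by rewrite ler_wpM2l ?sqr_ge0// ler_wpM2l// mulr_ge0 ?sqr_ge0.
Qed.

End Optimal.
End Strom.

(** * The optimality conditions *)

(* The sigma-algebra is arbitrary: it is the one generated by [G], which may
   itself be any sigma-algebra on C^np. A measure space with carrier P is
   recovered as the trace on the measurable set P. *)
Theorem corollary2p2 (R : realType) (np no ni r qA qB qC : nat)
  (np_gt0 : (0 < np)%N) (no_gt0 : (0 < no)%N) (ni_gt0 : (0 < ni)%N)
  (r_gt0 : (0 < r)%N)
  (qA_gt0 : (0 < qA)%N) (qB_gt0 : (0 < qB)%N) (qC_gt0 : (0 < qC)%N)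
  (G : set (set 'cV[R[i]]_np))
  (mu : {measure set (g_sigma_algebraType G) -> \bar R})
  (P : set (g_sigma_algebraType G)) (mP : measurable P)
  (H : g_sigma_algebraType G -> 'M[R[i]]_(no, ni)) (HL2 : mxL2 mu P H)
  (alpha : 'I_qA -> g_sigma_algebraType G -> R[i])
  (beta : 'I_qB -> g_sigma_algebraType G -> R[i])
  (gamma : 'I_qC -> g_sigma_algebraType G -> R[i])
  (malpha : forall i, cmeasurable P (alpha i))
  (mbeta : forall j, cmeasurable P (beta j))
  (mgamma : forall k, cmeasurable P (gamma k))
  (habc : (\int[mu]_(p in P)
      ((((\sum_(j < qB) cabs (beta j p)) * (\sum_(k < qC) cabs (gamma k p)))%R%:E
        / (\sum_(i < qA) cabs (alpha i p))%R%:E) ^+ 2) < +oo)%E)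
  (s : strom R r ni no qA qB qC)
  (hopt : L2_optimal mu P alpha beta gamma H
            (SigmaSt mu mP alpha) s) :
  [/\ forall k : 'I_qC,
        eq_mxintegral mu P
          (fun p => (gamma k p)^* *: (H p *m (redX alpha beta s p)^t*))
          (fun p => (gamma k p)^* *:
             (redH alpha beta gamma s p *m (redX alpha beta s p)^t*)),
      forall j : 'I_qB,
        eq_mxintegral mu P
          (fun p => (beta j p)^* *: (redXd alpha gamma s p *m H p))
          (fun p => (beta j p)^* *:
             (redXd alpha gamma s p *m redH alpha beta gamma s p))
    & forall i : 'I_qA,
        eq_mxintegral mu P
          (fun p => (alpha i p)^* *:
             (redXd alpha gamma s p *m H p *m (redX alpha beta s p)^t*))
          (fun p => (alpha i p)^* *:
             (redXd alpha gamma s p *m redH alpha beta gamma s p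
                *m (redX alpha beta s p)^t*))].
Proof.
have iw := integrable_sqr_strom_weight malpha mbeta mgamma habc.
split=> [k|j|i].
- exact: optimality_C.
- exact: optimality_B.
- exact: optimality_A.
Qed.
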